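(* Let $m=m_n$ be a sequence of positive integers with $m\to\infty$ and $m=o(n^{1/3})$ as $n\to\infty$. For each $n$ let $f$ (depending on $m$) be a probability density function on $\nabla_{m-1}$ which is Lipschitz on the closure $\overline{\nabla}_{m-1}$, and assume that the Lipschitz constants satisfy $\|f\|_{Lip}\le K$ for an absolute constant $K>0$ (not depending on $n$ or $m$). For each $n$ let $\kappa=(k_1,\ldots,k_m)\in\mathcal{P}_n(m)$ be chosen with probability $$P_n(\kappa)=c\cdot f\Big(\frac{k_1}{n},\ldots,\frac{k_m}{n}\Big),\qquad c=c_{n,m}=\Big(\sum_{(k_1,\ldots,k_m)\in\mathcal{P}_n(m)}f\Big(\frac{k_1}{n},\ldots,\frac{k_m}{n}\Big)\Big)^{-1}.$$ Let $(X_{m,1},\ldots,X_{m,m})$ be a random vector with density function $f(y_1,\ldots,y_m)$ on $\nabla_{m-1}$. If $(X_{m,1},\ldots,X_{m,m})$ converges weakly to a random element $X$ of $\nabla$ as $n\to\infty$, then $\big(\frac{k_1}{n},\ldots,\frac{k_m}{n}\big)$ converges weakly to $X$ as $n\to\infty$.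
   Context: For integers $n,m\ge 1$, $\mathcal{P}_n(m)$ denotes the set of partitions of $n$ with at most $m$ parts; its elements are written as $\kappa=(k_1,\ldots,k_m)$ with integers $k_1\ge k_2\ge\cdots\ge k_m\ge 0$ and $\sum_{i=1}^m k_i=n$ (shorter partitions are padded with zeros). The ordered $(m-1)$-dimensional simplex is $$\nabla_{m-1}=\Big\{(y_1,\ldots,y_m)\in[0,1]^m;\ y_1>y_2>\cdots>y_{m-1}>y_m\ \text{ and }\ y_m=1-\sum_{i=1}^{m-1}y_i\Big\},$$ and $\overline{\nabla}_{m-1}$ is its closure. Densities on $\nabla_{m-1}$ are with respect to Lebesgue measure $dy_1\cdots dy_{m-1}$ in the first $m-1$ coordinates (with $y_m=1-\sum_{i=1}^{m-1}y_i$). $\|f\|_{Lip}=\sup_{x\ne y}|f(x)-f(y)|/|x-y|$ over $x,y\in\overline{\nabla}_{m-1}$, with $|\cdot|$ the Euclidean norm. Further, $$\nabla=\Big\{(y_1,y_2,\ldots)\in[0,1]^{\infty};\ y_1\ge y_2\ge\cdots\ \text{ and }\ \sum_{i=1}^{\infty}y_i\le 1\Big\}.$$ Finite vectors $(x_1,\ldots,x_m)$ are regarded as elements of $[0,1]^\infty$ by appending zeros. A sequence $X_n=(X_{n1},X_{n2},\ldots)$ of random elements of $[0,1]^\infty$ converges weakly to $X=(X_1,X_2,\ldots)$ if for every $r\ge 1$, $(X_{n1},\ldots,X_{nr})$ converges weakly to $(X_1,\ldots,X_r)$; this is the same as weak convergence in $[0,1]^\infty$ with the product topology. *)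

(* Defs.v *)
From HB Require Import structures.
From mathcomp Require Import all_boot all_order all_algebra.
From mathcomp Require Import all_classical all_reals all_analysis.

Set Implicit Arguments.
Unset Strict Implicit.
Unset Printing Implicit Defensive.

Import Order.TTheory GRing.Theory Num.Theory.
Import numFieldNormedType.Exports.
Local Open Scope classical_set_scope.
Local Open Scope ring_scope.

Section LebesgueTuple.
Variable R : realType.

Definition tuple_cons n (p : measurableTypeR R * n.-tuple (measurableTypeR R)) :
    n.+1.-tuple (measurableTypeR R) := [tuple of p.1 :: p.2].

Definition tuple_uncons n (t : n.+1.-tuple (measurableTypeR R)) :
    measurableTypeR R * n.-tuple (measurableTypeR R) :=
  (thead t, [tuple of behead t]).

Lemma measurable_tuple_cons n : measurable_fun [set: _] (@tuple_cons n).
Proof. exact: measurable_cons. Qed.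

Lemma measurable_tuple_uncons n : measurable_fun [set: _] (@tuple_uncons n).
Proof.
apply: measurable_fun_pair; first exact: measurable_tnth.
exact: measurable_behead.
Qed.

Lemma tuple_consK n : cancel (@tuple_cons n) (@tuple_uncons n).
Proof.
by move=> [x y]; apply: injective_projections => //=; exact/val_inj.
Qed.

Section ConsMeasure.
Variable n : nat.
Variable mu :
  {sigma_finite_measure set (n.-tuple (measurableTypeR R)) -> \bar R}.

(* The product of the Lebesgue measure on R and mu, carried to R^(n+1). *)
Definition cons_measure : set (n.+1.-tuple (measurableTypeR R)) -> \bar R :=
  pushforward (lebesgue_measure \x mu)%E (@tuple_cons n).

Let measurable_preimage_cons A : measurable A ->
  measurable (@tuple_cons n @^-1` A).
Proof.
by move=> mA; rewrite -[X in measurable X]setTI; exact: measurable_tuple_cons.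
Qed.

Let cons_measure0 : cons_measure set0 = 0%E.
Proof. by rewrite /cons_measure /pushforward preimage_set0 measure0. Qed.

Let cons_measure_ge0 A : (0 <= cons_measure A)%E.
Proof. by rewrite /cons_measure /pushforward; exact: measure_ge0. Qed.

Let cons_measure_sigma_additive : semi_sigma_additive cons_measure.
Proof.
move=> F mF tF mUF; rewrite /cons_measure /pushforward preimage_bigcup.
apply: measure_semi_sigma_additive.
- by move=> i; exact: measurable_preimage_cons.
- apply/trivIsetP => i j _ _ ij; rewrite -preimage_setI.
  by move/trivIsetP : tF => /(_ _ _ _ _ ij) ->//; rewrite preimage_set0.
- by rewrite -preimage_bigcup; exact: measurable_preimage_cons.
Qed.

HB.instance Definition _ := isMeasure.Build _ _ _ cons_measure
  cons_measure0 cons_measure_ge0 cons_measure_sigma_additive.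

Let cons_measure_sigma_finite : sigma_finite setT cons_measure.
Proof.
have /sigma_finiteP[F [TF ndF Foo]] := sigma_finiteT (@lebesgue_measure R).
have /sigma_finiteP[G [TG ndG Goo]] := sigma_finiteT mu.
exists (fun i => @tuple_uncons n @^-1` (F i `*` G i)).
  rewrite -preimage_bigcup (_ : \bigcup_i (F i `*` G i) = setT) ?preimage_setT//.
  rewrite -subTset => -[x y] _.
  have [i _ Fx] : (\bigcup_i F i) x by rewrite -TF.
  have [j _ Gy] : (\bigcup_i G i) y by rewrite -TG.
  exists (maxn i j) => //; split => /=.
  - by move: x Fx; exact/subsetPset/ndF/leq_maxl.
  - by move: y Gy; exact/subsetPset/ndG/leq_maxr.
move=> i; have [mF Fi] := Foo i; have [mG Gi] := Goo i; split.
  rewrite -[X in measurable X]setTI; apply: measurable_tuple_uncons => //.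
  exact: measurableX.
rewrite /cons_measure /pushforward -comp_preimage.
rewrite (_ : _ \o _ = id); last by apply/funext => p; exact: tuple_consK.
by rewrite preimage_id product_measure1E// lte_mul_pinfty// ge0_fin_numE.
Qed.

HB.instance Definition _ := @Measure_isSigmaFinite.Build _ _ _
  cons_measure cons_measure_sigma_finite.

End ConsMeasure.

Fixpoint lebesgue_tuple n :
    {sigma_finite_measure set (n.-tuple (measurableTypeR R)) -> \bar R} :=
  match n with
  | 0 => \d_ [tuple]
  | n'.+1 => cons_measure (lebesgue_tuple n')
  end.

End LebesgueTuple.

Section Simplex.
Variables (R : realType) (m : nat).
Implicit Types (x y : m.-tuple R) (f : m.-tuple R -> R).

(* The condition y_m = 1 - (y_1 + ... + y_(m-1)) is the last one. *)
Definition ordered_simplex : set (m.-tuple R) :=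
  [set y | [/\ forall i : 'I_m, 0 <= tnth y i <= 1,
               forall i j : 'I_m, (i < j)%N -> tnth y j < tnth y i &
               \sum_(i < m) tnth y i = 1]].

(* Tuples carry the sigma-algebra of R^m but no topology in the library, row
   vectors carry the topology: this is the identity of R^m. *)
Definition row_of_tuple y : 'rV[R]_m := \row_i tnth y i.

Definition closed_ordered_simplex : set (m.-tuple R) :=
  row_of_tuple @^-1` closure (row_of_tuple @` ordered_simplex).

Definition euclidean_dist x y : R :=
  Num.sqrt (\sum_(i < m) (tnth x i - tnth y i) ^+ 2).

(* Equal to -oo if m = 1, the closed simplex being then a single point. *)
Definition lip_norm f : \bar R :=
  ereal_sup [set (`|f x.1 - f x.2| / euclidean_dist x.1 x.2)%:E |
    x in [set x : m.-tuple R * m.-tuple R |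
      [/\ closed_ordered_simplex x.1, closed_ordered_simplex x.2 &
          x.1 <> x.2]]].

(* (y_1, ..., y_(m-1)) |-> (y_1, ..., y_(m-1), 1 - (y_1 + ... + y_(m-1))) *)
Definition simplex_chart (y : m.-1.-tuple (measurableTypeR R)) :
    m.-tuple (measurableTypeR R) :=
  [tuple nth (1 - \sum_(j < m.-1) (tnth y j : R)) (y : seq R) i | i < m].

(* The integral of f over ordered_simplex `&` A with respect to
   dy_1 ... dy_(m-1). *)
Definition simplex_integral f (A : set (m.-tuple (measurableTypeR R))) :
    \bar R :=
  (\int[@lebesgue_tuple R m.-1]_(y in simplex_chart @^-1`
     (ordered_simplex `&` A)) (f (simplex_chart y))%:E)%E.

Definition is_simplex_pdf f : Prop :=
  [/\ measurable_fun (simplex_chart @^-1` ordered_simplex) (f \o simplex_chart),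
      forall y, ordered_simplex y -> 0 <= f y &
      simplex_integral f setT = 1%E].

Definition has_simplex_density d (T : measurableType d) (P : probability T R)
    (X : {RV P >-> m.-tuple (measurableTypeR R)}) f : Prop :=
  forall A, measurable A -> distribution P X A = simplex_integral f A.

End Simplex.

Definition partitions (n m : nat) : set (m.-tuple nat) :=
  [set k | sorted geq k /\ sumn k = n].

(* Hence a sum over [partitions n m] is never the default 0 given to sums with
   infinite support. *)
Lemma finite_partitions n m : finite_set (@partitions n m).
Proof.
pose F (t : m.-tuple 'I_n.+1) : m.-tuple nat := [tuple of map val t].
apply: (@sub_finite_set _ _ (F @` setT)); last exact/finite_image/finite_finset.
move=> k [_ kn]; exists (map_tuple (fun i => inord i) k) => //.
apply/val_inj; rewrite /= -map_comp -[RHS]map_id; apply/eq_in_map => i ik /=.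
rewrite inordK// ltnS -kn.
elim: (tval k) ik => //= a s IH; rewrite inE => /predU1P[->|/IH].
  exact: leq_addr.
by move/leq_trans; apply; exact: leq_addl.
Qed.

Section RandomPartition.
Variables (R : realType) (n m : nat) (f : m.-tuple R -> R).

Definition rescale (k : m.-tuple nat) : m.-tuple R :=
  [tuple of [seq i%:R / n%:R | i <- k]].

Definition partition_const : R :=
  (\sum_(k \in @partitions n m) f (rescale k))^-1.

Definition partition_prob (k : m.-tuple nat) : R :=
  partition_const * f (rescale k).

End RandomPartition.

Section WeakConvergence.
Variable R : realType.

Definition nabla : set (nat -> R) :=
  [set y | [/\ forall i, 0 <= y i <= 1,
               forall i, y i.+1 <= y i &
               (\sum_(0 <= i <oo) (y i)%:E <= 1)%E]].

Definition pad m (x : m.-tuple R) : nat -> R := fun i => nth 0 x i.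

Definition weak_cvg_vec r (d1 : nat -> measure_display)
    (T1 : forall n, measurableType (d1 n)) (P1 : forall n, probability (T1 n) R)
    (Y1 : forall n, T1 n -> 'rV[R]_r)
    d (T : measurableType d) (P : probability T R) (Y : T -> 'rV[R]_r) : Prop :=
  forall g : 'rV[R]_r -> R, continuous g -> bounded_fun g ->
    'E_(P1 n)[g \o Y1 n]%E @[n --> \oo] --> 'E_P[g \o Y]%E.

Definition weak_cvg_seq (d1 : nat -> measure_display)
    (T1 : forall n, measurableType (d1 n)) (P1 : forall n, probability (T1 n) R)
    (X1 : forall n, T1 n -> nat -> R)
    d (T : measurableType d) (P : probability T R) (X : T -> nat -> R) : Prop :=
  forall r, (0 < r)%N ->
    weak_cvg_vec P1 (fun n w => \row_(i < r) X1 n w i)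
                 P (fun w => \row_(i < r) X w i).

End WeakConvergence.

(* Main.v *)
(** The ordered simplex has volume V <= 8 / 2^m, while a probability density f
    with Lipschitz constant at most K oscillates by at most 2 K; hence
    |f - 1 / V| <= 2 K is negligible against 1 / V, and both laws are nearly
    uniform.

    Rounding y in the simplex to a partition of n (multiply the coordinates by
    N = n - (m-1)^2, round down, add m - 1, and let the last part absorb the
    error) moves y by O(m^2 / n), and at most a volume N^-(m-1) is sent to any
    given partition.  Conversely, disjoint cubes of side 1 / N' with
    N' = n + O(m^2), one for each partition, fit in the simplex, so that there
    are at most V N'^(m-1) partitions.  Together these bounds show that the
    rounded random vector takes each value with probability at most
    (1 + o(1)) (N' / N)^(m-1) times that of the random partition, where
    (N' / N)^(m-1) = exp (O(m^3 / n)) -> 1.  Between two probabilities this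
    one-sided comparison already makes the expectations of bounded functions
    close. *)

Require Import Defs.
From HB Require Import structures.
From mathcomp Require Import all_boot all_order all_algebra.
From mathcomp Require Import all_classical all_reals all_analysis.
From mathcomp Require Import measurable_realfun ring lra zify.

Set Implicit Arguments.
Unset Strict Implicit.
Unset Printing Implicit Defensive.

Import Order.TTheory GRing.Theory Num.Theory.
Import numFieldNormedType.Exports.
Local Open Scope classical_set_scope.
Local Open Scope ring_scope.

(** * Measurability and comparison of expectations *)

(** The preimage of any set is a countable union of level sets of [h]. Nothing is required of [F],
    and [S] carries no sigma-algebra. *)
Lemma measurable_comp_countable d (T : measurableType d) (S : countType)
    d' (U : measurableType d') (h : T -> S) (F : S -> U) :
  (forall s, measurable (h @^-1` [set s])) -> measurable_fun setT (F \o h).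
Proof.
move=> mh _ Y _; rewrite setTI.
rewrite (_ : _ @^-1` _ =
    \bigcup_s (if `[< Y (F s) >] then h @^-1` [set s] else set0)).
  apply: countable_bigcupT_measurable => [|s]; first exact: countableP.
  by case: ifP => // _; exact: measurable0.
apply/seteqP; split => [x YFx|x [s _]].
  by exists (h x) => //; rewrite ifT//; exact/asboolP.
by case: ifPn => // /asboolP YFs /= ->.
Qed.

(** Singletons are finite intersections of coordinate events, and the space is countable. Hence any
    function of a random partition is measurable. *)
Lemma measurable_tuple_nat m (A : set (m.-tuple nat)) : measurable A.
Proof.
apply: countable_measurable => [k|]; last exact: countableP.
rewrite (_ : [set k] = \bigcap_(i in setT)
    (fun t => tnth t i) @^-1` [set tnth k i]).
  apply: fin_bigcap_measurable => [|i _]; first exact: finite_finset.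
  by rewrite -[X in measurable X]setTI; exact: measurable_tnth.
apply/seteqP; split => [t -> //|t kt].
by apply: eq_from_tnth => i; exact: kt.
Qed.

Lemma floor_approx (R : realType) (x y : R) : 0 < y ->
  `|x - (Num.floor (y * x))%:~R / y| <= y^-1.
Proof.
move=> y0; have /andP[h1 h2] := floor_itv (y * x).
rewrite [X in `|X|](_ : _ = (y * x - (Num.floor (y * x))%:~R) / y).
  by rewrite normrM normfV (gtr0_norm y0) ler_piMl ?invr_ge0 1?ltW// ger0_norm;
    rewrite intrD in h2; lra.
by field; rewrite gt_eqF.
Qed.

Lemma measurable_floor_level (R : realType) d (T : measurableType d) r
    (y : 'I_r -> T -> R) (s : {ffun 'I_r -> int}) :
  (forall i, measurable_fun setT (y i)) ->
  measurable ((fun w => [ffun i => Num.floor (y i w)]) @^-1` [set s]).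
Proof.
move=> my; rewrite (_ : _ @^-1` _ =
    \bigcap_(i in setT) y i @^-1` `[(s i)%:~R, (s i + 1)%:~R[).
  apply: fin_bigcap_measurable => [|i _]; first exact: finite_finset.
  by rewrite -[X in measurable X]setTI; exact: my.
apply/seteqP; split => w /=.
  by move=> <- i _; rewrite ffunE /= in_itv/= floor_itv.
move=> H; apply/ffunP => i; rewrite ffunE; apply: floor_def.
by have := H i I; rewrite /= in_itv.
Qed.

(** Rounding [Y] down to the grid of mesh 1 / (j + 1) leaves countably many values. As [g] is
    continuous, [g \o Y] is the pointwise limit of these measurable approximations. *)
Lemma measurable_continuous_comp_row (R : realType) d (T : measurableType d) r
    (Y : T -> 'rV[R]_r) (g : 'rV[R]_r -> R) :
  (forall i, measurable_fun setT (fun w => Y w ord0 i)) -> continuous g ->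
  measurable_fun setT (g \o Y).
Proof.
move=> mY cg.
pose h j w : {ffun 'I_r -> int} := [ffun i => Num.floor (j.+1%:R * Y w ord0 i)].
pose F j (s : {ffun 'I_r -> int}) := g (\row_i ((s i)%:~R / j.+1%:R)).
apply: (@measurable_fun_cvg _ _ _ _ (fun j => F j \o h j)).
  move=> j; apply: measurable_comp_countable => s.
  by apply: measurable_floor_level => i; exact: measurable_funM.
move=> w _; apply: (cvg_comp (fun j => \row_i ((h j w i)%:~R / j.+1%:R)) g).
  2: exact: cg.
apply/cvg_ballP => e e0; near=> j; split => // a b.
rewrite mxE ffunE (ord1 a) /ball/=.
apply: (le_lt_trans (floor_approx _ _)); first by rewrite ltr0n.
near: j; exact: (near_infty_natSinv_lt (PosNum e0)).
Unshelve. all: by end_near.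
Qed.

(** Heine-Cantor with only [x] confined to the compact set: each point has a neighbourhood and a
    range of radii that work together, and the near-covering form of compactness yields one radius
    for all of [A]. *)
Lemma compact_unif_continuous (R : realType) r (A : set 'rV[R]_r)
    (g : 'rV[R]_r -> R) : compact A -> continuous g ->
  forall e : R, 0 < e -> exists2 dl : R, 0 < dl &
    forall x y : 'rV[R]_r, A x -> (forall i, `|x ord0 i - y ord0 i| < dl) ->
      `|g x - g y| <= e.
Proof.
move=> /compact_near_coveringP cA cg e e0.
pose P (dl : R) (x : 'rV[R]_r) := forall y : 'rV[R]_r,
  (forall i, `|x ord0 i - y ord0 i| < dl) -> `|g x - g y| <= e.
have : \forall dl \near 0^'+, A `<=` P dl.
  apply: cA => x Ax.
  have e20 : 0 < e / 2 by lra.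
  have /nbhs_ballP[dl /= dl0 H] : \forall y \near x, `|g x - g y| < e / 2.
    by have /cvgrPdist_lt/(_ _ e20) := cg x.
  exists (ball x (dl / 2), [set t | t < dl / 2]).
    split; first by apply: nbhsx_ballx; lra.
    by apply: nbhs_right_lt; lra.
  move=> [x' t]/= [xx' tdl] y x'y; have [_ xx'b] := xx'.
  have gx' : `|g x - g x'| < e / 2 by apply: H; apply: le_ball xx'; lra.
  have gy : `|g x - g y| < e / 2.
    apply: H; split => // a b; rewrite (ord1 a); have := xx'b ord0 b; have := x'y b.
    rewrite /ball/= => h1 h2.
    by have := ler_distD (x' ord0 b) (x ord0 b) (y ord0 b); lra.
  by rewrite distrC in gx'; have := ler_distD (g x) (g x') (g y); lra.
move=> H; have [dl [dl0 Hdl]] : exists dl, 0 < dl /\ A `<=` P dl.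
  near (0:R)^'+ => dl; exists dl.
  by split; [near: dl; exact: nbhs_right_gt|near: dl].
exists dl => // x y Ax; exact: Hdl.
Unshelve. all: by end_near.
Qed.

Lemma bounded_integrable d (T : measurableType d) (R : realType)
    (mu : probability T R) (h : T -> R) (B : R) :
  measurable_fun setT h -> (forall x, `|h x| <= B) ->
  mu.-integrable setT (EFin \o h).
Proof.
move=> mh hB; apply: measurable_bounded_integrable => //.
  by rewrite -ge0_fin_numE ?fin_num_measure.
exists B; split; rewrite ?num_real// => M BM x _ /=.
exact: le_trans (hB x) (ltW BM).
Qed.

Lemma Rintegral_probability_cst d (T : measurableType d) (R : realType)
    (mu : probability T R) (r : R) : \int[mu]_x (cst r x) = r.
Proof. by rewrite Rintegral_cst//= probability_setT mulr1. Qed.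

(** Since [h + B] is nonnegative, domination of the measures passes to its integrals. Subtracting
    [B] leaves the error e (B + int h dmu), which is at most 2 B e. *)
Lemma le_Rintegral_dominated d (T : measurableType d) (R : realType)
    (mu nu : probability T R) (h : T -> R) (B e : R) : 0 <= e ->
  (forall A, measurable A -> (nu A <= (1 + e)%:E * mu A)%E) ->
  measurable_fun setT h -> (forall x, `|h x| <= B) ->
  \int[nu]_x h x <= \int[mu]_x h x + 2 * B * e.
Proof.
move=> e0 numu mh hB.
have ih (m : probability T R) := bounded_integrable m mh hB.
have iB (m : probability T R) : m.-integrable setT (EFin \o cst B).
  apply: (@bounded_integrable _ _ _ _ _ `|B|) => //.
have e1 : 0 <= 1 + e by lra.
have hB0 x : 0 <= h x + B by have := hB x; rewrite ler_norml => /andP[]; lra.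
have mhB : measurable_fun setT (fun x => (h x + B)%:E).
  by apply/measurable_EFinP; exact: measurable_funD.
have : (\int[nu]_x (h x + B)%:E <= (1 + e)%:E * \int[mu]_x (h x + B)%:E)%E.
  rewrite -[(1 + e)%R]/((NngNum e1)%:num) -ge0_integral_mscale//=.
    by apply: ge0_le_measure_integral => // x; rewrite lee_fin hB0.
  by move=> x _; rewrite lee_fin hB0.
have E (m : probability T R) :
    (\int[m]_x (h x + B)%:E = (\int[m]_x h x + B)%:E)%E.
  rewrite -[X in (_ + X)%:E](Rintegral_probability_cst m).
  rewrite -(RintegralD measurableT (ih m) (iB m)).
  rewrite fineK//; apply: integrable_fin_num => //.
  exact: (integrableD measurableT (ih m) (iB m)).
rewrite !E -EFinM lee_fin.
have : \int[mu]_x h x <= B.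
  rewrite -[leRHS](Rintegral_probability_cst mu).
  apply: (le_Rintegral measurableT (ih mu) (iB mu)) => x _.
  exact: le_trans (ler_norm _) (hB x).
nra.
Qed.

(** The one-sided comparison applied to [h] and to [- h]; both measures having mass 1, it bounds the
    difference from both sides. *)
Lemma Rintegral_dominated d (T : measurableType d) (R : realType)
    (mu nu : probability T R) (h : T -> R) (B e : R) : 0 <= e ->
  (forall A, measurable A -> (nu A <= (1 + e)%:E * mu A)%E) ->
  measurable_fun setT h -> (forall x, `|h x| <= B) ->
  `|\int[nu]_x h x - \int[mu]_x h x| <= 2 * B * e.
Proof.
move=> e0 numu mh hB; have ih (m : probability T R) := bounded_integrable m mh hB.
have IN (m : probability T R) : \int[m]_x (- h x) = - \int[m]_x h x.
  under eq_Rintegral do rewrite -mulN1r.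
  by rewrite (RintegralZl _ measurableT (ih m)) mulN1r.
have := le_Rintegral_dominated e0 numu mh hB.
have : \int[nu]_x (- h x) <= \int[mu]_x (- h x) + 2 * B * e.
  apply: le_Rintegral_dominated => //; first exact: measurableT_comp.
  by move=> x; rewrite normrN.
rewrite !IN ler_norml => ? ?; apply/andP; split; lra.
Qed.

(** * Volume of the ordered simplex and number of partitions *)

(** Half-open, so that adjacent cells of a grid are disjoint and integer parts are constant on the
    cells. *)
Definition box (R : realType) M (a b : 'I_M -> R) :
    set (M.-tuple (measurableTypeR R)) :=
  [set y | forall i, a i <= (tnth y i : R) < b i].

Lemma measurable_box (R : realType) M (a b : 'I_M -> R) : measurable (box a b).
Proof.
rewrite (_ : box a b = \bigcap_(i in setT) (fun y => tnth y i) @^-1` `[a i, b i[).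
  apply: fin_bigcap_measurable => [|i _]; first exact: finite_finset.
  by rewrite -[X in measurable X]setTI; exact: measurable_tnth.
by apply/seteqP; split => [y yab i _|y yab i] /=;
  [rewrite in_itv; exact: yab|have := yab i I; rewrite /= in_itv].
Qed.

Lemma lebesgue_tuple_box (R : realType) M (a b : 'I_M -> R) :
  (forall i, a i <= b i) ->
  lebesgue_tuple R M (box a b) = (\prod_(i < M) (b i - a i))%:E.
Proof.
elim: M a b => [|M IH] a b ab.
  rewrite big_ord0 /= diracE mem_set// => -[]//.
pose a' i := a (lift ord0 i); pose b' i := b (lift ord0 i).
rewrite /= /cons_measure /pushforward.
rewrite (_ : _ @^-1` _ = `[a ord0, b ord0[ `*` box a' b').
  rewrite product_measure1E//; last exact: measurable_box.
  rewrite IH; last by move=> i; exact: ab.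
  rewrite big_ord_recl EFinM; congr (_ * _)%E.
  apply: (etrans (lebesgue_measure_itv `[a ord0, b ord0[)).
  rewrite /= lte_fin; case: ltP => // ba.
  by rewrite [b _](@le_anti _ _ _ (a ord0)) ?ba ?ab// subrr.
apply/seteqP; split => [[x y] H|[x y] /= [xab yab] i] /=.
  split => [|i]; first by have := H ord0; rewrite in_itv.
  by have := H (lift ord0 i); rewrite tnthS.
by case: (unliftP ord0 i) => [j ->|->]; [rewrite tnthS; exact: yab|rewrite in_itv in xab].
Qed.

Lemma lift_ord_max M (i : 'I_M) : lift ord_max i = widen_ord (leqnSn M) i.
Proof. by apply/val_inj; rewrite /= /bump leqNgt ltn_ord. Qed.

Lemma simplex_chart_widen (R : realType) M (y : M.-tuple (measurableTypeR R))
    (i : 'I_M) :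
  tnth (simplex_chart (m := M.+1) y) (widen_ord (leqnSn M) i) = tnth y i.
Proof. by rewrite tnth_mktuple /= (tnth_nth 0) (set_nth_default 0) ?size_tuple. Qed.

Lemma simplex_chart_max (R : realType) M (y : M.-tuple (measurableTypeR R)) :
  tnth (simplex_chart (m := M.+1) y) ord_max = 1 - \sum_(j < M) (tnth y j : R).
Proof. by rewrite tnth_mktuple nth_default//= size_tuple. Qed.

Lemma measurable_simplex_chart (R : realType) m :
  measurable_fun setT (@simplex_chart R m).
Proof.
apply/measurable_fun_tnthP => i.
have [im|mi] := ltnP i m.-1.
  rewrite (_ : _ \o _ = (fun y => tnth y (Ordinal im))); first exact: measurable_tnth.
  apply/funext => y /=.
  by rewrite tnth_mktuple (tnth_nth 0) (set_nth_default 0) ?size_tuple.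
rewrite (_ : _ \o _ = (fun y => 1 - \sum_(j < m.-1) (tnth y j : R))).
  apply: measurable_funB => //; apply: measurable_sum => j; exact: measurable_tnth.
by apply/funext => y /=; rewrite tnth_mktuple nth_default// size_tuple.
Qed.

Lemma measurable_ordered_simplex (R : realType) m :
  measurable (@ordered_simplex R m : set (m.-tuple (measurableTypeR R))).
Proof.
pose x i (y : m.-tuple (measurableTypeR R)) : R := tnth y i.
have mx i : measurable_fun setT (x i) by exact: measurable_tnth.
rewrite (_ : @ordered_simplex R m = ((\bigcap_(i in setT) x i @^-1` `[0, 1])
  `&` (\bigcap_(p in [set p : 'I_m * 'I_m | (p.1 < p.2)%N])
        (x p.1 \- x p.2) @^-1` `]0, +oo[)
  `&` (fun y => \sum_(i < m) x i y) @^-1` [set 1])).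
  apply: measurableI; first apply: measurableI.
  - apply: fin_bigcap_measurable => [|i _]; first exact: finite_finset.
    by rewrite -[X in measurable X]setTI; exact: mx.
  - apply: fin_bigcap_measurable => [|i _]; first exact: finite_finset.
    rewrite -[X in measurable X]setTI.
    by apply: measurable_funB.
  - rewrite -[X in measurable X]setTI.
    have ms : measurable_fun setT (fun y => \sum_(i < m) x i y) by exact: measurable_sum.
    exact: ms.
apply/seteqP; split => y /=.
  move=> [y01 ydec ysum]; split => //; split.
    by move=> i _; rewrite /= in_itv; exact: y01.
  by move=> [i j] /= ij; rewrite in_itv/= andbT subr_gt0; exact: ydec.
move=> [[y01 ydec] ysum]; split => //.
  by move=> i; have := y01 i I; rewrite /= in_itv.
by move=> i j ij; have := ydec (i, j) ij; rewrite /= in_itv/= andbT subr_gt0.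
Qed.

Lemma partitionsP n m (k : m.-tuple nat) : partitions n k <->
  (forall i j : 'I_m, (i <= j)%N -> (tnth k j <= tnth k i)%N) /\
  (\sum_(i < m) tnth k i = n)%N.
Proof.
have -> : (\sum_(i < m) tnth k i = sumn k)%N.
  by rewrite sumnE big_tuple.
split=> [[ks kn]|[ks kn]]; split => //.
  move=> i j ij; rewrite !(tnth_nth 0%N).
  apply: (@sorted_leq_nth _ geq) => //; rewrite ?inE ?size_tuple//.
  - by move=> a b c /= h1 h2; exact: leq_trans h2 h1.
  - by move=> a /=.
apply/(sortedP 0%N) => i; rewrite size_tuple => im.
have := ks (Ordinal (ltnW im)) (Ordinal im); rewrite !(tnth_nth 0%N) /=; exact.
Qed.

(** This coordinate is smaller than the first one, and the two sum to at most 1. *)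
Lemma ordered_simplex_lt_half (R : realType) M (y : M.+1.-tuple R) (i : 'I_M.+1) :
  ordered_simplex y -> (0 < i)%N -> tnth y i < 1 / 2.
Proof.
move=> [y01 ydec ysum] i0; have := ydec ord0 i i0.
move: ysum; rewrite big_ord_recl /=.
case: (unliftP ord0 i) i0 => [j -> _|->//].
rewrite (bigD1 j)//=.
have : 0 <= \sum_(k < M | k != j) tnth y (lift ord0 k).
  by apply: sumr_ge0 => k _; have /andP[] := y01 (lift ord0 k).
lra.
Qed.

(** The parameter domain in R^(m-1); its Lebesgue measure is the volume of the ordered simplex. *)
Definition simplex_domain (R : realType) m :
    set (m.-1.-tuple (measurableTypeR R)) :=
  @simplex_chart R m @^-1` @ordered_simplex R m.

Lemma measurable_simplex_domain (R : realType) m :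
  measurable (@simplex_domain R m).
Proof.
rewrite -[X in measurable X]setTI; apply: measurable_simplex_chart => //.
exact: measurable_ordered_simplex.
Qed.

(** All coordinates but the first are below 1/2, so the domain fits in a box with M - 1 sides equal
    to 1/2. *)
Lemma simplex_volume_le (R : realType) M :
  (lebesgue_tuple R M (@simplex_domain R M.+1) <=
   (4 / 2 ^+ M)%:E)%E.
Proof.
(* The first side is 2 because a half-open side of length 1 would miss a first coordinate equal to
   1. *)
pose b (i : 'I_M) : R := if i == 0%N :> nat then 2 else 1 / 2.
have b0 i : 0 <= b i by rewrite /b; case: ifP => _; lra.
apply: (@le_trans _ _ (lebesgue_tuple R M (box (fun=> 0) b))).
  apply: le_measure; rewrite ?inE.
  - exact: (@measurable_simplex_domain R M.+1).
  - exact: measurable_box.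
  move=> y Dy i; have [y01 _ _] := Dy.
  have := y01 (widen_ord (leqnSn M) i); rewrite simplex_chart_widen => /andP[-> /= y1].
  rewrite /b; case: (eqVneq (i : nat) 0%N) => [i0|i0]; first by lra.
  rewrite -simplex_chart_widen; apply: ordered_simplex_lt_half => //.
  by rewrite lt0n.
rewrite lebesgue_tuple_box// lee_fin.
case: M @b b0 => [|M] b b0; first by rewrite big_ord0 expr0; lra.
rewrite big_ord_recl /= (eq_bigr (fun=> 1 / 2)) => [|i _]; last by rewrite subr0.
rewrite prodr_const card_ord exprS subr0 /b /= expr_div_n expr1n.
have : 0 < (2 : R) ^+ M by rewrite exprn_gt0.
move=> h; rewrite [leRHS](_ : _ = 2 * (1 / 2 ^+ M))//; field; rewrite gt_eqF//.
Qed.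

(* The shift by [2 m - i] makes the coordinates strictly decreasing and leaves
   room below the last of them for [y_m], which absorbs the rounding errors. *)
Definition cell_shift M i := (2 * M.+1 - i)%N.

(** The numerators of the lower corner of a cell plus the last part of the partition sum to n plus
    all the shifts. The additional M bounds what the sides of the cube add, so that the last
    coordinate stays nonnegative. *)
Definition cell_scale n M := (n + \sum_(i < M) cell_shift M i + M)%N.

Lemma cell_scale_gt0 (R : realType) n M : (0 < n)%N ->
  0 < ((cell_scale n M)%:R : R).
Proof. by move=> n0; rewrite ltr0n /cell_scale -addnA ltn_addr. Qed.

Definition partition_cell (R : realType) n M (k : M.+1.-tuple nat) :=
  box (fun i : 'I_M =>
         (tnth k (widen_ord (leqnSn M) i) + cell_shift M i)%:R / (cell_scale n M)%:R : R)
      (fun i : 'I_M =>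
         (tnth k (widen_ord (leqnSn M) i) + cell_shift M i).+1%:R / (cell_scale n M)%:R).

Arguments partition_cell R n {M} k _ : assert.

Lemma partition_cell_volume (R : realType) n M (k : M.+1.-tuple nat) : (0 < n)%N ->
  lebesgue_tuple R M (partition_cell R n k) = ((cell_scale n M)%:R^-1 ^+ M)%:E.
Proof.
move=> n0; rewrite lebesgue_tuple_box => [|i].
  under eq_bigr do rewrite -mulrBl -natrB// subSnn mul1r.
  by rewrite prodr_const card_ord.
by rewrite ler_pM2r ?ler_nat// invr_gt0 cell_scale_gt0.
Qed.

(** The shifted parts [c i] drop by at least 1 at each step, so points of the cube have strictly
    decreasing coordinates. The remaining coordinate [z] satisfies 0 <= N z <= k_last + M, which is
    below every [c i] because each shift exceeds M. *)
Lemma partition_cell_subset (R : realType) n M (k : M.+1.-tuple nat) : (0 < n)%N ->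
  partitions n k -> partition_cell R n k `<=` @simplex_domain R M.+1.
Proof.
move=> n0 /partitionsP[kdec ksum] y yk.
set N := cell_scale n M in yk *.
have N0 : 0 < (N%:R : R) by exact: cell_scale_gt0.
pose c (i : 'I_M) := (tnth k (widen_ord (leqnSn M) i) + cell_shift M i)%N.
pose x (i : 'I_M) : R := tnth y i.
have lo i : (c i)%:R <= N%:R * x i.
  by have /andP[] := yk i; rewrite ler_pdivrMr// mulrC.
have hi i : N%:R * x i < (c i).+1%:R.
  by have /andP[_] := yk i; rewrite ltr_pdivlMr// mulrC.
have Nsum : (N = \sum_(i < M) c i + tnth k ord_max + M)%N.
  by rewrite /N /cell_scale -ksum big_ord_recr /= /c big_split /=; lia.
have slo : (\sum_(i < M) c i)%:R <= N%:R * \sum_(i < M) x i.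
  by rewrite mulr_sumr natr_sum ler_sum.
have shi : N%:R * \sum_(i < M) x i <= (\sum_(i < M) c i + M)%:R.
  rewrite mulr_sumr (_ : _ + M = \sum_(i < M) (c i).+1)%N.
    by rewrite natr_sum ler_sum// => i _; exact/ltW/hi.
  by rewrite -[X in (_ + X)%N](card_ord M) -sum1_card -big_split /=;
    apply: eq_bigr => i _; rewrite addn1.
pose z : R := 1 - \sum_(i < M) x i.
have zlo : 0 <= z.
  rewrite -(pmulr_rge0 _ N0) /z mulrBr mulr1 subr_ge0 (le_trans shi)// ler_nat.
  by rewrite Nsum; lia.
have zhi : N%:R * z <= (tnth k ord_max + M)%:R.
  rewrite /z mulrBr mulr1 lerBlDr.
  rewrite [leLHS](_ : _ = (tnth k ord_max + M)%:R + (\sum_(i < M) c i)%:R).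
    by rewrite lerD2l.
  by rewrite -natrD Nsum; congr (_%:R); lia.
have x0 i : 0 <= x i by rewrite -(pmulr_rge0 _ N0) (le_trans _ (lo i)).
have xx (i j : 'I_M) : (i < j)%N -> x j < x i.
  move=> ij; rewrite -(ltr_pM2l N0) (lt_le_trans (hi j))// (le_trans _ (lo i))//.
  rewrite ler_nat /c /cell_shift.
  have := kdec (widen_ord (leqnSn M) i) (widen_ord (leqnSn M) j) (ltnW ij).
  have := ltn_ord j; lia.
have xz i : z < x i.
  rewrite -(ltr_pM2l N0) (le_lt_trans zhi)// (lt_le_trans _ (lo i))//.
  rewrite ltr_nat /c /cell_shift.
  have := kdec (widen_ord (leqnSn M) i) ord_max.
  by have := ltn_ord i => /= ? /(_ (ltnW _)) ; lia.
have ysum : \sum_(i < M.+1) (tnth (simplex_chart (m := M.+1) y) i : R) = 1.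
  rewrite big_ord_recr /= simplex_chart_max.
  under eq_bigr do rewrite simplex_chart_widen.
  by rewrite addrCA subrr addr0.
have y0 i : 0 <= (tnth (simplex_chart (m := M.+1) y) i : R).
  case: (unliftP ord_max i) => [j|] ->; last by rewrite simplex_chart_max.
  by rewrite lift_ord_max simplex_chart_widen.
split=> // [i|i j].
  rewrite y0 -ysum (bigD1 i)//= lerDl; exact: sumr_ge0.
case: (unliftP ord_max i) => [i'|] ->; last by have := ltn_ord j => /=; lia.
rewrite lift_ord_max simplex_chart_widen.
case: (unliftP ord_max j) => [j'|] ->; last by rewrite simplex_chart_max.
by rewrite lift_ord_max simplex_chart_widen => ij; exact: xx.
Qed.

(** Half-open unit intervals with integer endpoints that meet are equal, so the first M parts agree;
    the last part is then determined by the sum n. *)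
Lemma trivIset_partition_cell (R : realType) n M : (0 < n)%N ->
  trivIset (@partitions n M.+1) (partition_cell R n).
Proof.
move=> n0 k k' /partitionsP[_ kn] /partitionsP[_ k'n] [y [yk yk']].
have N0 := cell_scale_gt0 R M n0.
have kk' i : tnth k (widen_ord (leqnSn M) i) = tnth k' (widen_ord (leqnSn M) i).
  have /andP[h1 h2] := yk i; have /andP[h3 h4] := yk' i.
  have := le_lt_trans h1 h4; have := le_lt_trans h3 h2.
  by rewrite !(ltr_pM2r (_ : 0 < _^-1)) ?invr_gt0// !ltr_nat; lia.
apply: eq_from_tnth => i; case: (unliftP ord_max i) => [j|] ->.
  by rewrite lift_ord_max kk'.
move: kn; rewrite -k'n !big_ord_recr /=.
under eq_bigr do rewrite kk'.
exact: addnI.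
Qed.

(** Packing bound: the cells are disjoint subsets of the domain. It says that the number of
    partitions is at most V N'^M, where N' is [cell_scale n M]. *)
Lemma partitions_volume (R : realType) n M : (0 < n)%N ->
  (\sum_(k \in @partitions n M.+1) ((cell_scale n M)%:R^-1 ^+ M : R)%:E <=
   lebesgue_tuple R M (@simplex_domain R M.+1))%E.
Proof.
move=> n0; under eq_fsbigr => k _ do rewrite -(partition_cell_volume R k n0).
have mc k : @partitions n M.+1 k -> measurable (partition_cell R n k).
  by move=> _; exact: measurable_box.
rewrite -measure_fin_bigcup//; last 2 first.
- exact: finite_partitions.
- exact: trivIset_partition_cell.
apply: le_measure; rewrite ?inE.
- by apply: fin_bigcup_measurable => //; exact: finite_partitions.
- exact: (@measurable_simplex_domain R M.+1).
by apply: bigcup_sub => k pk; exact: partition_cell_subset.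
Qed.

(** * Rounding the simplex to partitions *)

Definition round_scale n m := (n - m.-1 ^ 2)%N.

Definition round_coord (R : realType) n m (t : m.-tuple R) (i : 'I_m) :=
  (Num.truncn ((round_scale n m)%:R * tnth t i) + m.-1)%N.

(* Scaling by [n - (m - 1) ^ 2] only and then adding [m - 1] to each of the
   first [m - 1] rounded coordinates makes room for the last part, which takes
   up the sum of the rounding errors, not to exceed the others. *)
Definition round_partition (R : realType) n m (t : m.-tuple R) : m.-tuple nat :=
  [tuple if (i < m.-1)%N then round_coord n t i
         else (n - \sum_(j < m | (j < m.-1)%N) round_coord n t j)%N | i < m].

(** The rounding depends on [t] only through the integer parts of the scaled coordinates, that is,
    through a countable set of integer vectors. *)
Lemma measurable_round_level (R : realType) n m (k : m.-tuple nat) :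
  measurable ((fun t : m.-tuple (measurableTypeR R) => round_partition n t)
    @^-1` [set k]).
Proof.
pose y (i : 'I_m) (t : m.-tuple (measurableTypeR R)) : R :=
  (round_scale n m)%:R * tnth t i.
(* The value 0 on negative integers matches [Num.truncn], which sends negative numbers to 0. *)
pose q (s : {ffun 'I_m -> int}) i :=
  ((if s i is Posz c then c else 0) + m.-1)%N.
pose F (s : {ffun 'I_m -> int}) : m.-tuple nat :=
  [tuple if (i < m.-1)%N then q s i
         else (n - \sum_(j < m | (j < m.-1)%N) q s j)%N | i < m].
have my i : measurable_fun setT (y i).
  by apply: measurable_funM => //; exact: measurable_tnth.
rewrite (_ : (fun t => _) = F \o (fun t => [ffun i => Num.floor (y i t)])).
  rewrite -[X in measurable X]setTI; apply: measurable_comp_countable => //.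
    by move=> s; exact: measurable_floor_level.
  exact: measurable_tuple_nat.
apply/funext => t; apply: eq_from_tnth => i; rewrite !tnth_mktuple.
have qE j : q [ffun i => Num.floor (y i t)] j = round_coord n t j.
  by rewrite /q /round_coord ffunE truncEfloor.
by rewrite qE; under [in RHS]eq_bigr do rewrite qE.
Qed.

Lemma measurable_round_partition (R : realType) n m :
  measurable_fun setT
    (fun t : m.-tuple (measurableTypeR R) => round_partition n t).
Proof.
apply: (@measurable_comp_countable _ _ (m.-tuple nat) _ (m.-tuple nat)
  (fun t => round_partition n t) id) => k.
exact: measurable_round_level.
Qed.

Lemma sum_widen_ord M (F : 'I_M.+1 -> nat) :
  (\sum_(j < M.+1 | (j < M)%N) F j = \sum_(j < M) F (widen_ord (leqnSn M) j))%N.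
Proof.
rewrite big_mkcond big_ord_recr /= ltnn addn0.
by apply: eq_bigr => i _; rewrite ltn_ord.
Qed.

(** Let S be the sum of the first M rounded parts. Rounding down gives S <= N - N y_last + M^2 <= n,
    so the subtraction defining the last part is not truncated. Each rounding loses less than 1,
    whence n - S <= N y_last + M. *)
Lemma round_partition_partitions (R : realType) n M (t : M.+1.-tuple R) :
  (M ^ 2 <= n)%N -> ordered_simplex t -> partitions n (round_partition n t).
Proof.
move=> Mn [t01 tdec tsum].
set N : R := (round_scale n M.+1)%:R.
have N0 : 0 <= N by rewrite ler0n.
have NE : N = n%:R - M%:R ^+ 2 by rewrite /N /round_scale /= natrB// natrX.
pose w := widen_ord (leqnSn M).
pose x i := N * tnth t i.
have x0 i : 0 <= x i by apply: mulr_ge0 => //; have /andP[] := t01 i.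
pose c i := Num.truncn (x i).
have clo i : (c i)%:R <= x i by have /andP[] := truncn_itv (x0 i).
have chi i : x i < (c i).+1%:R by have /andP[] := truncn_itv (x0 i).
have xsum : \sum_(i < M) x (w i) + x ord_max = N.
  by rewrite -[RHS]mulr1 -tsum mulr_sumr big_ord_recr.
pose S := (\sum_(i < M) (c (w i) + M))%N.
have SE : S = (\sum_(i < M) c (w i) + M ^ 2)%N.
  by rewrite /S big_split/= sum_nat_const card_ord.
have Slo : S%:R <= \sum_(i < M) x (w i) + M%:R ^+ 2.
  by rewrite SE natrD natrX lerD2r natr_sum ler_sum.
have Sn : (S <= n)%N.
  by rewrite -(ler_nat R) (le_trans Slo)//; have := x0 ord_max; lra.
have Shi : \sum_(i < M) x (w i) + M%:R ^+ 2 <= S%:R + M%:R.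
  rewrite SE natrD natrX addrAC lerD2r natr_sum -[X in _ + X%:R](card_ord M) -sum1_card.
  rewrite natr_sum -big_split/= ler_sum// => i _.
  by have := chi (w i); rewrite -natr1 => /ltW.
have rw i : tnth (round_partition n t) (w i) = (c (w i) + M)%N.
  by rewrite tnth_mktuple /= ltn_ord.
have rmax : tnth (round_partition n t) ord_max = (n - S)%N.
  by rewrite tnth_mktuple /= ltnn sum_widen_ord.
have dec (i j : 'I_M.+1) : (i <= j)%N -> x j <= x i.
  rewrite leq_eqVlt => /predU1P[/val_inj -> //|ij].
  by apply: ler_wpM2l => //; exact/ltW/tdec.
apply/partitionsP; split; last first.
  rewrite big_ord_recr /= rmax; under eq_bigr do rewrite rw.
  by rewrite -/S subnKC.
move=> i j; case: (unliftP ord_max j) => [j'|] ->;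
  case: (unliftP ord_max i) => [i'|] ->; rewrite ?lift_ord_max -/w.
- by move=> ij; rewrite !rw leq_add2r le_truncn// dec.
- by move=> /=; rewrite leqNgt ltn_ord.
(* Here n - S <= x_last + M <= x_i + M < c_i + 1 + M, and the outer terms are integers. *)
- move=> _; rewrite rw rmax -ltnS -(ltr_nat R) natrB//.
  have := dec (w i') ord_max (ltnW (ltn_ord i')); have := chi (w i').
  by rewrite -addSn natrD; lra.
- by [].
Qed.

(** With N = n - M^2, the part k lies within 1 of N u + M, so k - n u is M - M^2 u up to an error of
    1. The first M coordinates suffice, since weak convergence tests only a fixed number of them. *)
Lemma round_partition_close (R : realType) n M (t : M.+1.-tuple R) (i : 'I_M) :
  (M ^ 2 <= n)%N -> (0 < n)%N -> ordered_simplex t ->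
  `|(tnth (round_partition n t) (widen_ord (leqnSn M) i))%:R / n%:R -
    tnth t (widen_ord (leqnSn M) i)| <= (M.+1 ^ 2)%:R / n%:R.
Proof.
move=> Mn n0 [t01 _ _]; set u := tnth t _; set k := tnth _ _.
have nR : 0 < (n%:R : R) by rewrite ltr0n.
have /andP[u0 u1] := t01 (widen_ord (leqnSn M) i); rewrite -/u in u0 u1.
set N : R := (round_scale n M.+1)%:R.
have N0 : 0 <= N by rewrite ler0n.
have NE : N = n%:R - M%:R ^+ 2 by rewrite /N /round_scale /= natrB// natrX.
have kE : (k%:R : R) = (Num.truncn (N * u))%:R + M%:R.
  by rewrite /k tnth_mktuple /= ltn_ord /round_coord natrD.
have /andP[] := truncn_itv (mulr_ge0 N0 u0); rewrite -natr1 => h1 h2.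
rewrite [X in `|X|](_ : _ = (k%:R - n%:R * u) / n%:R); last first.
  by field; rewrite gt_eqF.
rewrite normrM normfV (gtr0_norm nR) ler_pM2r ?invr_gt0//.
rewrite natrX -natr1 kE ler_norml NE in h1 h2 *.
have M0 : 0 <= (M%:R : R) by rewrite ler0n.
apply/andP; split; nra.
Qed.

(** A prescribed value of the rounding confines each of the first M coordinates to an interval of
    length 1 / N. The endpoints use real subtraction, so parts smaller than M do no harm. *)
Lemma round_partition_level (R : realType) n M (k : M.+1.-tuple nat) :
  (M ^ 2 < n)%N ->
  (lebesgue_tuple R M
    (@simplex_chart R M.+1 @^-1` (@ordered_simplex R M.+1 `&`
      (fun t => round_partition n t) @^-1` [set k])) <=
   ((round_scale n M.+1)%:R^-1 ^+ M : R)%:E)%E.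
Proof.
move=> Mn; set N := round_scale n M.+1.
have N0 : 0 < (N%:R : R) by rewrite ltr0n /N subn_gt0.
pose a (i : 'I_M) : R := ((tnth k (widen_ord (leqnSn M) i))%:R - M%:R) / N%:R.
pose b (i : 'I_M) : R := ((tnth k (widen_ord (leqnSn M) i))%:R - M%:R + 1) / N%:R.
have bo : lebesgue_tuple R M (box a b) = (N%:R^-1 ^+ M)%:E.
  rewrite lebesgue_tuple_box => [|i].
    under eq_bigr do rewrite /a /b -mulrBl addrAC subrr add0r mul1r.
    by rewrite prodr_const card_ord.
  by rewrite ler_pM2r ?invr_gt0// lerDl.
rewrite -bo; apply: le_measure; rewrite ?inE.
- rewrite -[X in measurable X]setTI; apply: (@measurable_simplex_chart R M.+1) => //.
  apply: measurableI; first exact: measurable_ordered_simplex.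
  exact: measurable_round_level.
- exact: measurable_box.
move=> y [[y01 _ _] /= yk] i; rewrite /a /b -yk.
rewrite tnth_mktuple /= ltn_ord /round_coord simplex_chart_widen natrD addrK.
have := y01 (widen_ord (leqnSn M) i); rewrite simplex_chart_widen => /andP[y0 _].
have /andP[] := truncn_itv (mulr_ge0 (ltW N0) y0); rewrite -natr1 => h1 h2.
by rewrite ler_pdivrMr// ltr_pdivlMr// ![_ * N%:R]mulrC; apply/andP; split.
Qed.

(** * Lipschitz densities are nearly uniform *)

(** Weak inequalities admit the rescaled partitions, whose parts may coincide. *)
Definition weak_simplex (R : realType) m : set (m.-tuple R) :=
  [set x | [/\ forall i, 0 <= tnth x i,
               forall i j : 'I_m, (i <= j)%N -> tnth x j <= tnth x i &
               \sum_(i < m) tnth x i = 1]].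
Arguments weak_simplex {R m} x.

Lemma ordered_simplex_weak (R : realType) m (x : m.-tuple R) :
  ordered_simplex x -> weak_simplex x.
Proof.
move=> [x01 xdec xsum]; split=> // [i|i j]; first by have /andP[] := x01 i.
by rewrite leq_eqVlt => /predU1P[/val_inj -> //|/xdec/ltW].
Qed.

Lemma rescale_weak (R : realType) n m (k : m.-tuple nat) : (0 < n)%N ->
  partitions n k -> weak_simplex (rescale R n k).
Proof.
move=> n0 /partitionsP[kdec kn]; have nR : 0 < (n%:R : R) by rewrite ltr0n.
split=> [i|i j ij|]; rewrite ?tnth_map.
- by rewrite divr_ge0.
- by rewrite ler_pM2r ?invr_gt0// ler_nat kdec.
- under eq_bigr do rewrite tnth_map.
  by rewrite -mulr_suml -natr_sum kn divff// gt_eqF.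
Qed.

(** The witness is proportional to (m, m - 1, ..., 1). *)
Lemma ordered_simplex_neq0 (R : realType) m : (0 < m)%N ->
  exists v : m.-tuple R, ordered_simplex v.
Proof.
move=> m0; pose s := (\sum_(i < m) (m - i))%N.
have s0 : (0 < s)%N by rewrite /s (bigD1 (Ordinal m0))//= subn0 ltn_addr.
have sR : 0 < (s%:R : R) by rewrite ltr0n.
exists [tuple (m - i)%:R / s%:R | i < m]; split=> [i|i j ij|].
- rewrite tnth_mktuple divr_ge0//= ler_pdivrMr// mul1r ler_nat.
  by rewrite /s (bigD1 i)//= leq_addr.
- rewrite !tnth_mktuple ltr_pM2r ?invr_gt0// ltr_nat.
  by have := ltn_ord j; lia.
- under eq_bigr do rewrite tnth_mktuple.
  by rewrite -mulr_suml -natr_sum divff// gt_eqF.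
Qed.

Lemma weak_simplex_le1 (R : realType) m (x : m.-tuple R) i :
  weak_simplex x -> tnth x i <= 1.
Proof. by move=> [x0 _ <-]; rewrite (bigD1 i)//= lerDl sumr_ge0. Qed.

(** Moving [x] slightly along the segment towards a strictly ordered point [v] makes all
    inequalities strict, so [x] is a limit of points of the ordered simplex. *)
Lemma weak_simplex_closed (R : realType) m (x : m.-tuple R) : (0 < m)%N ->
  weak_simplex x -> closed_ordered_simplex x.
Proof.
move=> m0 Wx; have [v Sv] := ordered_simplex_neq0 R m0.
have [x0 xdec xsum] := Wx; have [v01 vdec vsum] := Sv.
have x1 i := weak_simplex_le1 i Wx.
move=> B /nbhs_ballP[e /= e0 eB].
pose t := Num.min (e / 2) (1 / 2).
have t0 : 0 < t by rewrite lt_min; apply/andP; split; lra.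
have te : t < e by rewrite gt_min; apply/orP; left; lra.
have t1 : t < 1 by rewrite gt_min; apply/orP; right; lra.
pose z : m.-tuple R := [tuple (1 - t) * tnth x i + t * tnth v i | i < m].
exists (row_of_tuple z); split.
  exists z => //; split=> [i|i j ij|].
  - rewrite tnth_mktuple; have /andP[] := v01 i; have := x0 i; have := x1 i.
    by move=> ? ? ? ?; apply/andP; split; nra.
  - rewrite !tnth_mktuple; have := vdec i j ij; have := xdec i j (ltnW ij).
    by move=> ? ?; nra.
  - under eq_bigr do rewrite tnth_mktuple.
    by rewrite big_split/= -!mulr_sumr xsum vsum; lra.
apply: eB; split=> // a b; rewrite /ball/= !mxE tnth_mktuple.
rewrite (_ : _ - _ = t * (tnth x b - tnth v b)); last by ring.
rewrite normrM (gtr0_norm t0) (le_lt_trans _ te)// ler_piMr ?(ltW t0)//.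
have /andP[v0 v1] := v01 b; have := x0 b; have := x1 b.
by move=> ? ?; rewrite ler_norml; apply/andP; split; lra.
Qed.

(** The diameter is bounded independently of the dimension: (x_i - y_i)^2 <= x_i + y_i on [0, 1],
    and the right-hand sides sum to 2. *)
Lemma lip_norm_oscillation (R : realType) m (f : m.-tuple R -> R) (K : R)
    (x y : m.-tuple R) : (0 < m)%N -> 0 <= K -> (lip_norm f <= K%:E)%E ->
  weak_simplex x -> weak_simplex y -> `|f x - f y| <= 2 * K.
Proof.
move=> m0 K0 fK Wx Wy.
have [->|xy] := eqVneq x y; first by rewrite subrr normr0 mulr_ge0.
have [x0 _ xsum] := Wx; have [y0 _ ysum] := Wy.
set d := euclidean_dist x y.
have d2 : d <= 2.
  rewrite -(@ger0_norm _ 2)// -sqrtr_sqr ler_wsqrtr//.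
  apply: (@le_trans _ _ 2); last by rewrite expr2; lra.
  rewrite -[leRHS]/(1 + 1) -[X in X + _]xsum -ysum -big_split/= ler_sum// => i _.
  have := x0 i; have := y0 i.
  have := weak_simplex_le1 i Wx; have := weak_simplex_le1 i Wy.
  by nra.
have d0 : 0 < d.
  rewrite lt_def sqrtr_ge0 andbT; apply: contra_neq xy => /eqP.
  rewrite sqrtr_eq0 => dle; apply: eq_from_tnth => i.
  have s0 j : 0 <= (tnth x j - tnth y j) ^+ 2 by exact: sqr_ge0.
  have : (tnth x i - tnth y i) ^+ 2 <= 0.
    by apply: le_trans dle; rewrite (bigD1 i)//= lerDl sumr_ge0.
  by rewrite real_exprn_even_le0 ?num_real//= subr_eq0 => /eqP.
have : `|f x - f y| / d <= K.
  rewrite -lee_fin; apply: le_trans fK; apply: ereal_sup_ubound.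
  exists (x, y) => //=; split; [exact: weak_simplex_closed..|exact/eqP].
by rewrite ler_pdivrMr// => /le_trans; apply; rewrite mulrC ler_wpM2r.
Qed.

Definition simplex_volume (R : realType) m : R :=
  fine (lebesgue_tuple R m.-1 (@simplex_domain R m)).

Lemma simplex_volumeE (R : realType) M :
  lebesgue_tuple R M (@simplex_domain R M.+1) = (simplex_volume R M.+1)%:E.
Proof.
rewrite /simplex_volume fineK// ge0_fin_numE; last exact: measure_ge0.
exact: le_lt_trans (simplex_volume_le R M) (ltry _).
Qed.

Section NearlyUniformDensity.
Variables (R : realType) (M : nat) (f : M.+1.-tuple R -> R) (K : R).
Hypotheses (K_ge0 : 0 <= K) (f_pdf : is_simplex_pdf f)
  (f_lip : (lip_norm f <= K%:E)%E).
Let V := simplex_volume R M.+1.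

Let V_ge0 : 0 <= V.
Proof. exact: fine_ge0. Qed.

Let integral_f : (\int[lebesgue_tuple R M]_(y in @simplex_domain R M.+1)
  (f (simplex_chart (m := M.+1) y))%:E = 1)%E.
Proof.
have [_ _] := f_pdf; rewrite /simplex_integral.
by rewrite (_ : ordered_simplex (m:=M.+1) `&` setT =
  ordered_simplex (m:=M.+1)) ?setIT.
Qed.

Let measurable_f : measurable_fun (@simplex_domain R M.+1)
  (fun y => (f (simplex_chart (m := M.+1) y))%:E).
Proof. by have [? _ _] := f_pdf; exact/measurable_EFinP. Qed.

Let measurable_D : measurable (@simplex_domain R M.+1 : set (M.-tuple (measurableTypeR R))).
Proof. exact: (@measurable_simplex_domain R M.+1). Qed.

Let f_near (x : M.+1.-tuple R) y : weak_simplex x -> @simplex_domain R M.+1 y ->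
  f x - 2 * K <= f (simplex_chart (m := M.+1) y) <= f x + 2 * K.
Proof.
move=> Wx Dy.
have := lip_norm_oscillation (ltn0Sn M) K_ge0 f_lip Wx (ordered_simplex_weak Dy).
by rewrite ler_norml => /andP[? ?]; apply/andP; split; lra.
Qed.

(** Integrate f(y) <= f(x) + 2 K over the domain, where [f] has integral 1. *)
Lemma pdf_lower (x : M.+1.-tuple R) : weak_simplex x -> 1 <= (f x + 2 * K) * V.
Proof.
move=> Wx; rewrite -lee_fin -integral_f EFinM -simplex_volumeE.
rewrite -(integral_cst _ measurable_D); apply: ge0_le_integral => //.
- by move=> y Dy; have [_ + _] := f_pdf => /(_ _ Dy); rewrite lee_fin.
- by move=> y Dy; rewrite /= lee_fin; have /andP[] := f_near Wx Dy.
Qed.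

(** With V = 0 the bound [pdf_lower] would read 1 <= 0. *)
Lemma simplex_volume_gt0 : 0 < V.
Proof.
have [v Sv] := ordered_simplex_neq0 R (ltn0Sn M).
have := pdf_lower (ordered_simplex_weak Sv).
by have := V_ge0; rewrite le_eqVlt => /predU1P[<-|//]; lra.
Qed.

Lemma pdf_upper (x : M.+1.-tuple R) : weak_simplex x -> (f x - 2 * K) * V <= 1.
Proof.
(* The integrals are compared for nonnegative functions only; if the lower bound is not positive,
   the left-hand side is at most 0 anyway. *)
move=> Wx; have [fK|fK] := leP (f x - 2 * K) 0.
  by apply: (@le_trans _ _ 0) => //; exact: mulr_le0_ge0.
rewrite -lee_fin -integral_f EFinM -simplex_volumeE.
rewrite -(integral_cst _ measurable_D); apply: ge0_le_integral => //.
- by move=> y Dy; rewrite /= lee_fin ltW.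
- by move=> y Dy; rewrite /= lee_fin; have /andP[] := f_near Wx Dy.
Qed.

Lemma simplex_integral_le (A : set (M.+1.-tuple (measurableTypeR R))) :
  measurable A ->
  (simplex_integral f A <= (V^-1 + 2 * K)%:E *
    lebesgue_tuple R M (@simplex_chart R M.+1 @^-1` (@ordered_simplex R M.+1 `&` A)))%E.
Proof.
move=> mA; have V0 := simplex_volume_gt0; rewrite /simplex_integral.
have mDA : measurable (@simplex_chart R M.+1 @^-1` (@ordered_simplex R M.+1 `&` A)
    : set (M.-tuple (measurableTypeR R))).
  rewrite -[X in measurable X]setTI; apply: (@measurable_simplex_chart R M.+1) => //.
  by apply: measurableI => //; exact: measurable_ordered_simplex.
rewrite -(integral_cst _ mDA); apply: ge0_le_integral => //.
- by move=> y [Sy _]; have [_ + _] := f_pdf => /(_ _ Sy); rewrite lee_fin.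
- by apply: measurable_funS measurable_f => // y [].
- move=> y [Sy _]; rewrite /= lee_fin -lerBlDr -(ler_pM2r V0) mulVf ?gt_eqF//.
  exact/pdf_upper/ordered_simplex_weak.
Qed.

(** Relative deviation from the uniform density: on the weak simplex, (1 - e) / V <= f <= (1 + e) /
    V. *)
Let e := 2 * K * V.

(** Each term is at most (1 + e) / V, and the packing bound limits the number of terms to V N'^M. *)
Lemma partition_sum_le n : (0 < n)%N ->
  \sum_(k \in @partitions n M.+1) f (rescale R n k) <=
  (1 + e) * (cell_scale n M)%:R ^+ M.
Proof.
move=> n0; have V0 := simplex_volume_gt0.
have N0 := cell_scale_gt0 R M n0.
have := partitions_volume R M n0; rewrite simplex_volumeE.
rewrite !fsbig_finite/=; [|exact: finite_partitions..].
rewrite sumEFin lee_fin -/V => cV.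
apply: (@le_trans _ _ (\sum_(k <- finmap.enum_fset
    (fset_set (@partitions n M.+1))) (V^-1 + 2 * K))).
  rewrite !big_seq; apply: ler_sum => k.
  rewrite in_fset_set ?inE => [pk|]; last exact: finite_partitions.
  rewrite -lerBlDr -(ler_pM2r V0) mulVf ?gt_eqF//.
  exact/pdf_upper/rescale_weak.
rewrite -(ler_pM2r (_ : 0 < (cell_scale n M)%:R^-1 ^+ M)) ?exprn_gt0 ?invr_gt0//.
rewrite -mulrA -exprMn divff ?gt_eqF// expr1n mulr1 mulr_suml.
rewrite -mulr_sumr (le_trans (ler_wpM2l _ cV))//.
  by rewrite addr_ge0 ?invr_ge0 ?mulr_ge0.
by rewrite mulrDl mulVf ?gt_eqF.
Qed.

(** The left-hand side is at most (1 + e) / V times the volume N^-M of a level set of the rounding,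
    while the probability of [k] is at least (1 - e) / V divided by (1 + e) N'^M. The constant is
    the quotient of these two bounds. *)
Lemma round_partition_dominated n (k : M.+1.-tuple nat) :
  (M ^ 2 < n)%N -> e < 1 -> partitions n k ->
  (simplex_integral f
     ((fun t : M.+1.-tuple (measurableTypeR R) => round_partition n t)
       @^-1` [set k])
   <= ((1 + e) ^+ 2 / (1 - e) *
       ((cell_scale n M)%:R / (round_scale n M.+1)%:R) ^+ M *
       partition_prob n f k)%:E)%E.
Proof.
move=> Mn e1 pk; have n0 : (0 < n)%N by exact: leq_ltn_trans Mn.
have V0 := simplex_volume_gt0.
have e0 : 0 <= e by rewrite !mulr_ge0// ltW.
have K2 : 0 <= V^-1 + 2 * K by rewrite addr_ge0 ?invr_ge0 ?mulr_ge0.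
apply: (le_trans (simplex_integral_le (measurable_round_level n k))).
apply: (le_trans (lee_wpmul2l _ (round_partition_level R k Mn))).
  by rewrite lee_fin.
rewrite -EFinM lee_fin.
set N : R := (round_scale n M.+1)%:R; set N' : R := (cell_scale n M)%:R.
have N0 : 0 < N by rewrite ltr0n /round_scale subn_gt0.
have N'0 : 0 < N' by exact: cell_scale_gt0.
have f0 (k' : M.+1.-tuple nat) : partitions n k' -> (1 - e) / V <= f (rescale R n k').
  move=> pk'; rewrite ler_pdivrMr//.
  by have := pdf_lower (rescale_weak R n0 pk'); rewrite /e; lra.
rewrite /partition_prob /partition_const.
set S := \sum_(_ \in _) _.
have S_le : S <= (1 + e) * N' ^+ M by exact: partition_sum_le.
have fk := f0 k pk.
have fk0 : 0 < f (rescale R n k).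
  by rewrite (lt_le_trans _ fk)// divr_gt0// subr_gt0.
(* Positivity of the sum is needed to invert its upper bound; it comes from e < 1, which makes [f]
   positive at every rescaled partition. *)
have S0 : 0 < S.
  rewrite (lt_le_trans fk0)// /S fsbig_finite/=; last exact: finite_partitions.
  rewrite (bigD1_seq k)/=; last 2 first.
  - by rewrite in_fset_set ?inE//; exact: finite_partitions.
  - exact: finmap.fset_uniq.
  rewrite lerDl big_seq_cond sumr_ge0// => k' /andP[].
  rewrite in_fset_set ?inE => [pk' _|]; last exact: finite_partitions.
  by rewrite (le_trans _ (f0 _ pk'))// divr_ge0// ?subr_ge0 ltW.
have e10 : 0 < 1 - e by rewrite subr_gt0.
have NM0 : 0 < N ^+ M by rewrite exprn_gt0.
have N'M0 : 0 < N' ^+ M by rewrite exprn_gt0.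
apply: (@le_trans _ _ ((1 + e) ^+ 2 / (1 - e) * (N' / N) ^+ M *
    (((1 + e) * N' ^+ M)^-1 * ((1 - e) / V)))).
  rewrite expr_div_n exprVn [leRHS](_ : _ = (1 + e) / V / N ^+ M).
    rewrite [leLHS](_ : _ = (1 + e) / V / N ^+ M)// /e ?exprVn.
    by field; rewrite !gt_eqF.
  by field; rewrite !gt_eqF//; lra.
apply: ler_wpM2l.
  by rewrite !mulr_ge0 ?exprn_ge0 ?divr_ge0 ?addr_ge0 ?invr_ge0// ltW.
apply: ler_pM => //.
- by rewrite invr_ge0 mulr_ge0 ?addr_ge0// ltW.
- by rewrite divr_ge0// ltW.
- by rewrite lef_pV2// posrE// mulr_gt0// ltr_pwDl.
Qed.

End NearlyUniformDensity.

(** * Comparison of the two laws *)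

Lemma measurable_pad (R : realType) d (T : measurableType d) m
    (X : T -> m.-tuple (measurableTypeR R)) i :
  measurable_fun setT X -> measurable_fun setT (fun w => pad (X w) i : R).
Proof.
move=> mX; rewrite /pad; have [im|mi] := ltnP i m.
  rewrite (_ : (fun w => _) = (fun t => tnth t (Ordinal im)) \o X).
    by apply: measurableT_comp => //; exact: measurable_tnth.
  by apply/funext => w /=; rewrite (tnth_nth 0).
rewrite (_ : (fun w => _) = cst 0)//.
by apply/funext => w; rewrite nth_default ?size_tuple.
Qed.

Lemma measurable_continuous_pad (R : realType) d (T : measurableType d) m
    (X : T -> m.-tuple (measurableTypeR R)) r (g : 'rV[R]_r -> R) :
  measurable_fun setT X -> continuous g ->
  measurable_fun setT (fun w => g (\row_(i < r) pad (X w) i)).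
Proof.
move=> mX gc; apply: measurable_continuous_comp_row => // i.
rewrite (_ : (fun w => _) = (fun w => pad (X w) i)); first exact: measurable_pad.
by apply/funext => w; rewrite mxE.
Qed.

Section LawComparison.
Variables (R : realType) (n M : nat) (f : M.+1.-tuple R -> R) (K : R).
Hypotheses (K_ge0 : 0 <= K) (f_pdf : is_simplex_pdf f)
  (f_lip : (lip_norm f <= K%:E)%E) (Mn : (M ^ 2 < n)%N).
Variables (d1 : measure_display) (T1 : measurableType d1) (P1 : probability T1 R)
  (kappa : {RV P1 >-> M.+1.-tuple nat}).
Hypotheses (kappa_prob : forall k, partitions n k ->
    distribution P1 kappa [set k] = (partition_prob n f k)%:E).
Variables (d2 : measure_display) (T2 : measurableType d2) (P2 : probability T2 R)
  (Xm : {RV P2 >-> M.+1.-tuple (measurableTypeR R)}).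
Hypothesis Xm_density : has_simplex_density Xm f.

Let e := 2 * K * simplex_volume R M.+1.
Hypothesis e_lt1 : e < 1.

Definition dominating_ratio : R :=
  (1 + e) ^+ 2 / (1 - e) * ((cell_scale n M)%:R / (round_scale n M.+1)%:R) ^+ M.

Let e_ge0 : 0 <= e.
Proof. by rewrite !mulr_ge0// fine_ge0. Qed.

Let round := (fun t : M.+1.-tuple (measurableTypeR R) => round_partition n t).
Let measurable_round_comp : measurable_fun setT (round \o Xm).
Proof. exact: measurableT_comp (@measurable_round_partition R n M.+1) _. Qed.

Let Y : {RV P2 >-> M.+1.-tuple nat} := mfun_Sub (mem_set measurable_round_comp).

(** Both factors are at least 1: (1 + e)^2 >= 1 - e, and the scales satisfy N' >= n >= N. *)
Lemma dominating_ratio_ge1 : 1 <= dominating_ratio.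
Proof.
rewrite /dominating_ratio -[leLHS](mulr1 1) ler_pM//.
  rewrite ler_pdivlMr ?subr_gt0//; have := e_ge0; move: e => x x0; nra.
rewrite exprn_ege1// ler_pdivlMr ?ltr0n ?subn_gt0// mul1r ler_nat.
by rewrite (leq_trans (leq_subr _ _))// /cell_scale -addnA leq_addr.
Qed.

Lemma almost_surely_in_simplex : P2 (~` (Xm @^-1` @ordered_simplex R M.+1)) = 0%E.
Proof.
rewrite preimage_setC; apply: etrans (Xm_density _) _.
  by apply: measurableC; exact: measurable_ordered_simplex.
by rewrite /simplex_integral setICr preimage_set0 integral_set0.
Qed.

(** The rounded vector takes its values in the finite set of partitions, so the bound for single
    partitions can be summed. *)
Lemma law_dominated (A : set (M.+1.-tuple nat)) :
  (distribution P2 Y A <= dominating_ratio%:E * distribution P1 kappa A)%E.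
Proof.
have dY (B : set (M.+1.-tuple nat)) :
    distribution P2 Y B = simplex_integral f (round @^-1` B).
  rewrite -Xm_density// -[X in measurable X]setTI.
  by apply: measurable_round_partition => //; exact: measurable_tuple_nat.
pose p := @partitions n M.+1.
have fin : finite_set (A `&` p).
  by apply: sub_finite_set (@finite_partitions n M.+1) => k [].
have AE : A `&` p = \bigcup_(k in A `&` p) [set k].
  by rewrite (bigcup_imset1 _ id) image_id.
have sumE (mu : probability (M.+1.-tuple nat) R) :
    mu (A `&` p) = (\sum_(k \in A `&` p) mu [set k])%E.
  rewrite {1}AE measure_fin_bigcup//.
  - by move=> i j _ _ [x [-> ->]].
  - by move=> k _; exact: measurable_tuple_nat.
(* The density is integrated over the ordered simplex only, and there the rounding yields
   partitions. *)
have -> : distribution P2 Y A = distribution P2 Y (A `&` p).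
  rewrite !dY /simplex_integral; congr integral; congr (_ @^-1` _).
  apply/seteqP; split => t [St /= At]; split => //=; last by case: At.
  split=> //; apply: round_partition_partitions => //; exact: ltnW.
apply: (@le_trans _ _ (dominating_ratio%:E * distribution P1 kappa (A `&` p)))%E.
  rewrite (sumE (distribution P2 Y)) (sumE (distribution P1 kappa)).
  rewrite ge0_mule_fsumr//; apply: lee_fsum => // k [_ pk].
  have := round_partition_dominated K_ge0 f_pdf f_lip Mn e_lt1 pk.
  by rewrite EFinM -kappa_prob// -/round -dY.
apply: lee_wpmul2l.
  by rewrite lee_fin (le_trans _ dominating_ratio_ge1).
by apply: le_measure => //; rewrite inE; exact: measurable_tuple_nat.
Qed.

Variables (r : nat) (g : 'rV[R]_r -> R) (B eta : R).
Hypotheses (rM : (r <= M)%N) (g_cont : continuous g) (g_bound : forall x, `|g x| <= B)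
  (eta_ge0 : 0 <= eta)
  (g_close : forall x y : 'rV[R]_r, (forall i, 0 <= x ord0 i <= 1) ->
     (forall i, `|x ord0 i - y ord0 i| <= (M.+1 ^ 2)%:R / n%:R) ->
     `|g x - g y| <= eta).

Let G (k : M.+1.-tuple nat) := g (\row_(i < r) pad (rescale R n k) i).
Let H w := g (\row_(i < r) pad (Xm w) i).

Let measurable_H : measurable_fun setT H.
Proof. exact: measurable_continuous_pad. Qed.

Let measurable_G : measurable_fun setT G.
Proof. by move=> _ C _; exact: measurable_tuple_nat. Qed.

(** Triangle inequality through the rounded vector [Y]: its law is dominated by that of [kappa], and
    rounding changes [g] by at most [eta]. *)
Lemma expectation_close :
  `|\int[P1]_w G (kappa w) - \int[P2]_w H w| <=
  2 * B * (dominating_ratio - 1) + eta.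
Proof.
have n0 : (0 < n)%N by exact: leq_ltn_trans Mn.
have mG d (T : measurableType d) (P : probability T R)
    (Z : {RV P >-> M.+1.-tuple nat}) :
    measurable_fun setT (G \o Z).
  exact: (measurableT_comp measurable_G (measurable_funPT Z)).
have dist d (T : measurableType d) (P : probability T R)
    (Z : {RV P >-> M.+1.-tuple nat}) :
    \int[P]_w G (Z w) = \int[distribution P Z]_k G k.
  rewrite /Rintegral integral_distribution//; first exact/measurable_EFinP.
  exact: (bounded_integrable _ (mG _ _ _ Z) (fun w => g_bound _)).
have h1 : `|\int[distribution P2 Y]_k G k - \int[distribution P1 kappa]_k G k| <=
    2 * B * (dominating_ratio - 1).
  apply: Rintegral_dominated => //; first by rewrite subr_ge0 dominating_ratio_ge1.
  - by move=> A _; rewrite addrC subrK; exact: law_dominated.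
  - by move=> k; exact: g_bound.
have iG : P2.-integrable setT (EFin \o (fun w => G (Y w))).
  exact: (bounded_integrable _ (mG _ _ _ Y) (fun w => g_bound _)).
have iH : P2.-integrable setT (EFin \o H).
  exact: (bounded_integrable _ measurable_H (fun w => g_bound _)).
have h2 : `|\int[P2]_w G (Y w) - \int[P2]_w H w| <= eta.
  rewrite -RintegralB// -lee_fin EFin_normr_Rintegral//; last first.
    exact: (integrableB measurableT iG iH).
  have mGH : measurable_fun setT (fun w => G (Y w) - H w).
    by exact: (measurable_funB (mG _ _ _ Y) measurable_H).
  apply: le_trans (le_abse_integral _ _ _) _ => //; first exact/measurable_EFinP.
  apply: (@le_trans _ _ (\int[P2]_w (cst eta%:E w))%E); last first.
    by rewrite integral_cst//= probability_setT mule1.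
  (* The rounding is controlled on the ordered simplex only, so the integrands are compared almost
     everywhere. *)
  apply: ae_ge0_le_integral => //.
    by apply/measurable_EFinP; exact: measurableT_comp.
  exists (~` (Xm @^-1` @ordered_simplex R M.+1)); split.
  - apply: measurableC; rewrite -[X in measurable X]setTI.
    by apply: measurable_funPT => //; exact: measurable_ordered_simplex.
  - exact: almost_surely_in_simplex.
  apply: subsetC => w Sw _; rewrite /= lee_fin distrC.
  have rp (x : M.+1.-tuple R) (i : 'I_r) :
      pad x i = tnth x (widen_ord (leqnSn M) (widen_ord rM i)).
    by rewrite /pad (tnth_nth 0).
  apply: g_close => i; rewrite !mxE rp.
    by have [x01 _ _] := Sw; exact: x01.
  rewrite rp tnth_map distrC; apply: round_partition_close => //; exact: ltnW.
rewrite (dist _ _ _ Y) in h2; rewrite distrC in h1; rewrite dist.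
exact: le_trans (ler_distD (\int[distribution P2 Y]_k G k) _ _) (lerD h1 h2).
Qed.

End LawComparison.

(** With m = M + 1, the ratio N' / N is at most 1 + 6 m^2 / n <= exp (6 m^2 / n); its M-th power is
    at most exp (6 m^3 / n). *)
Lemma dominating_ratio_le (R : realType) n M (K : R) :
  (2 * M.+1 ^ 3 <= n)%N -> 0 <= K -> 2 * K * simplex_volume R M.+1 < 1 ->
  dominating_ratio n M K <=
  (1 + 2 * K * simplex_volume R M.+1) ^+ 2 / (1 - 2 * K * simplex_volume R M.+1)
  * expR (6 * (M.+1%:R ^+ 3 / n%:R)).
Proof.
move=> mn K0; rewrite /dominating_ratio; set e := 2 * K * _ => e1.
have e0 : 0 <= e by rewrite !mulr_ge0// fine_ge0.
have m2 : (2 * M.+1 ^ 2 <= n)%N.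
  by apply: leq_trans mn; rewrite leq_mul2l leq_pexp2l.
have n0 : (0 < n)%N by apply: leq_trans m2; rewrite muln_gt0 expn_gt0.
have nR : 0 < (n%:R : R) by rewrite ltr0n.
apply: ler_wpM2l; first by rewrite divr_ge0 ?sqr_ge0 ?subr_ge0 ?ltW.
have N'le : (cell_scale n M <= n + 2 * M.+1 ^ 2)%N.
  have : (\sum_(i < M) cell_shift M i <= \sum_(i < M) 2 * M.+1)%N.
    by apply: leq_sum => i _; exact: leq_subr.
  rewrite sum_nat_const card_ord /cell_scale.
  by move: (\sum_(i < M) _)%N => s; clear; nia.
have Nge : (n <= round_scale n M.+1 + M.+1 ^ 2)%N.
  by rewrite /round_scale /=; clear; nia.
have NR : 0 < ((round_scale n M.+1)%:R : R).
  by rewrite ltr0n /round_scale /=; move: m2; clear; nia.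
have ratio : (cell_scale n M)%:R / (round_scale n M.+1)%:R <=
    1 + 6 * (M.+1%:R ^+ 2 / n%:R) :> R.
  have H1 : (cell_scale n M)%:R <= n%:R + 2 * M.+1%:R ^+ 2 :> R.
    by move: N'le; rewrite -(ler_nat R) natrD natrM natrX.
  have H2 : n%:R <= (round_scale n M.+1)%:R + M.+1%:R ^+ 2 :> R.
    by move: Nge; rewrite -(ler_nat R) natrD natrX.
  have H3 : 2 * M.+1%:R ^+ 2 <= n%:R :> R.
    by move: m2; rewrite -(ler_nat R) natrM natrX.
  rewrite ler_pdivrMr// (le_trans H1)// -(ler_pM2r nR).
  (* The constant 6 comes from (n + 6 a) (n - a) - n (n + 2 a) = 3 a (n - 2 a) with a = m^2, which
     is nonnegative because 2 m^2 <= n. *)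
  rewrite [leRHS](_ : _ = (n%:R + 6 * M.+1%:R ^+ 2) * (round_scale n M.+1)%:R).
    have := sqr_ge0 (M.+1%:R : R); move: H2 H3 NR nR.
    move: (M.+1%:R ^+ 2) (n%:R : R) ((round_scale n M.+1)%:R : R) => a b c.
    by clear; nra.
  by field; rewrite gt_eqF.
apply: (@le_trans _ _ (expR (6 * (M.+1%:R ^+ 2 / n%:R)) ^+ M)).
  apply: lerXn2r; rewrite ?nnegrE ?expR_ge0 ?divr_ge0//.
  exact: le_trans ratio (expR_ge1Dx _).
rewrite -expRM_natl ler_expR mulrCA ler_pM2l// mulrA ler_pM2r ?invr_gt0//.
by rewrite [leRHS]exprS ler_wpM2r ?exprn_ge0// ler_nat.
Qed.

(** Stated for [m] rather than [M.+1], so that it applies to a dependent family [f n] directly, and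
    under conditions that hold for all large n. *)
Lemma expectation_partition_close (R : realType) (n m : nat) (f : m.-tuple R -> R)
    (K : R) (K_ge0 : 0 <= K) (f_pdf : is_simplex_pdf f)
    (f_lip : (lip_norm f <= K%:E)%E)
    d1 (T1 : measurableType d1) (P1 : probability T1 R)
    (kappa : {RV P1 >-> m.-tuple nat})
    (kappa_prob : forall k, partitions n k ->
      distribution P1 kappa [set k] = (partition_prob n f k)%:E)
    d2 (T2 : measurableType d2) (P2 : probability T2 R)
    (Xm : {RV P2 >-> m.-tuple (measurableTypeR R)})
    (Xm_density : has_simplex_density Xm f)
    (r : nat) (g : 'rV[R]_r -> R) (B eta dl : R) :
  (r < m)%N -> (2 * m ^ 3 <= n)%N -> 2 * K * simplex_volume R m < 1 ->
  continuous g -> (forall x, `|g x| <= B) -> 0 <= eta ->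
  m%:R ^+ 3 / n%:R < dl ->
  (forall x y : 'rV[R]_r, (forall i, 0 <= x ord0 i <= 1) ->
    (forall i, `|x ord0 i - y ord0 i| < dl) -> `|g x - g y| <= eta) ->
  `|\int[P1]_w g (\row_(i < r) pad (rescale R n (kappa w)) i) -
    \int[P2]_w g (\row_(i < r) pad (Xm w) i)| <=
  2 * B * ((1 + 2 * K * simplex_volume R m) ^+ 2 / (1 - 2 * K * simplex_volume R m)
    * expR (6 * (m%:R ^+ 3 / n%:R)) - 1) + eta.
Proof.
case: m f f_pdf f_lip kappa kappa_prob Xm Xm_density => [//|M] f f_pdf f_lip.
move=> kappa kappa_prob Xm Xm_density rM mn e1 gc gB eta0 ndl gdl.
have n0 : (0 < n)%N by apply: leq_trans mn; rewrite muln_gt0 expn_gt0.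
have Mn : (M ^ 2 < n)%N by apply: leq_trans mn; nia.
apply: le_trans (expectation_close K_ge0 f_pdf f_lip Mn kappa_prob Xm_density e1
  rM gc gB eta0 _) _.
  move=> x y x01 xy; apply: gdl => // i; apply: le_lt_trans (xy i) _.
  (* The displacement m^2 / n caused by rounding is at most m^3 / n, hence below [dl]. *)
  apply: le_lt_trans ndl; rewrite ler_pM2r ?invr_gt0 ?ltr0n// -natrX ler_nat.
  by rewrite leq_pexp2l.
have B0 : 0 <= B by exact: le_trans (normr_ge0 _) (gB 0).
by rewrite lerD2r ler_wpM2l ?mulr_ge0// lerD2r dominating_ratio_le.
Qed.

(** * Vanishing of the error terms and passage to the limit *)

Lemma simplex_volume_le_expr (R : realType) m : (0 < m)%N ->
  simplex_volume R m <= 8 * 2^-1 ^+ m.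
Proof.
case: m => // M _; have := simplex_volume_le R M.
rewrite simplex_volumeE lee_fin => /le_trans; apply.
by rewrite exprS exprVn; have : 0 <= ((2:R) ^+ M)^-1; [rewrite invr_ge0 exprn_ge0|lra].
Qed.

Lemma expectation_Rintegral d (T : measurableType d) (R : realType)
    (P : probability T R) (h : T -> R) (B : R) :
  measurable_fun setT h -> (forall x, `|h x| <= B) ->
  'E_P[h]%E = (\int[P]_w h w)%:E.
Proof.
move=> mh hB; rewrite unlock /Rintegral fineK//.
exact: (integrable_fin_num measurableT (bounded_integrable P mh hB)).
Qed.

Lemma cvg_cube_ratio (R : realType) (m : nat -> nat) :
  (fun n => (m n)%:R : R) =o_\oo (fun n => n%:R `^ 3^-1) ->
  ((m n)%:R ^+ 3 / n%:R : R) @[n --> \oo] --> 0.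
Proof.
move=> /eqoP mo; apply/cvgrPdist_le => e e0.
(* Capping d at 1 gives d^3 <= d <= e, which avoids a cube root of e. *)
pose d := Num.min e 1.
have d0 : 0 < d by rewrite lt_min e0 ltr01.
near=> n; have n0 : 0 < (n%:R : R) by rewrite ltr0n; near: n; exact: nbhs_infty_gt.
rewrite sub0r normrN ger0_norm ?divr_ge0 ?exprn_ge0// ler_pdivrMr//.
have : `|(m n)%:R| <= d * `|n%:R `^ 3^-1| by near: n; exact: mo.
rewrite ger0_norm// ger0_norm ?powR_ge0// => mn.
have -> : e * n%:R = e * (n%:R `^ 3^-1) ^+ 3.
  by rewrite -powR_mulrn ?powR_ge0// -powRrM mulVf// powRr1// ltW.
apply: (@le_trans _ _ ((d * n%:R `^ 3^-1) ^+ 3)).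
  by apply: lerXn2r mn; rewrite nnegrE// mulr_ge0 ?powR_ge0// ltW.
rewrite exprMn ler_wpM2r ?exprn_ge0 ?powR_ge0//.
have d1 : d <= 1 by rewrite ge_min lexx orbT.
apply: (@le_trans _ _ d); last by rewrite ge_min lexx.
by rewrite exprS ler_piMr ?exprn_ile1// ltW.
Unshelve. all: by end_near.
Qed.

Lemma cvg_simplex_volume (R : realType) (m : nat -> nat) :
  m n @[n --> \oo] --> \oo -> simplex_volume R (m n) @[n --> \oo] --> 0.
Proof.
move=> moo; apply: (@squeeze_cvgr _ _ _ _ (cst 0) (fun n => 8 * 2^-1 ^+ m n)).
- near=> n; rewrite fine_ge0//= simplex_volume_le_expr//; near: n.
  exact: (moo _ (nbhs_infty_gt 0%N)).
- exact: cvg_cst.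
rewrite -[X in _ --> X](mulr0 8); apply: cvgMl_tmp.
apply: (cvg_comp _ (fun k => 2^-1 ^+ k) moo); apply: cvg_expr.
by rewrite ger0_norm ?invr_ge0// invf_lt1// ltr1n.
Unshelve. all: by end_near.
Qed.

Theorem theorem4 (R : realType) (m : nat -> nat)
  (m_gt0 : forall n, (0 < n)%N -> (0 < m n)%N)
  (m_oo : m n @[n --> \oo] --> \oo)
  (m_littleo : (fun n => (m n)%:R : R) =o_\oo (fun n => n%:R `^ 3^-1))
  (f : forall n, (m n).-tuple R -> R)
  (f_pdf : forall n, (0 < n)%N -> is_simplex_pdf (f n))
  (K : R) (K_gt0 : 0 < K)
  (f_lip : forall n, (0 < n)%N -> (lip_norm (f n) <= K%:E)%E)
  (* the random partitions kappa n *)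
  (d1 : nat -> measure_display) (T1 : forall n, measurableType (d1 n))
  (P1 : forall n, probability (T1 n) R)
  (kappa : forall n, {RV (P1 n) >-> (m n).-tuple nat})
  (kappa_partition : forall n, (0 < n)%N ->
    forall w, partitions n (kappa n w))
  (kappa_prob : forall n, (0 < n)%N -> forall k, partitions n k ->
    distribution (P1 n) (kappa n) [set k] = (partition_prob n (f n) k)%:E)
  (* the random vectors with density f n *)
  (d2 : nat -> measure_display) (T2 : forall n, measurableType (d2 n))
  (P2 : forall n, probability (T2 n) R)
  (Xm : forall n, {RV (P2 n) >-> (m n).-tuple (measurableTypeR R)})
  (Xm_density : forall n, (0 < n)%N -> has_simplex_density (Xm n) (f n))
  (* the limit, a random element of nabla *)
  (d : measure_display) (T : measurableType d) (P : probability T R)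
  (X : T -> nat -> R)
  (X_measurable : forall i, measurable_fun setT (fun w => X w i))
  (X_nabla : forall w, nabla (X w)) :
  weak_cvg_seq P2 (fun n w => pad (Xm n w)) P X ->
  weak_cvg_seq P1 (fun n w => pad (rescale R n (kappa n w))) P X.
Proof.
move=> Xm_cvg r r_gt0 g g_cont g_bnd; have [B0 [_ gB0]] := g_bnd.
(* [bounded_fun] provides a bound for every number strictly above [B0]. *)
pose B := B0 + 1; have gB x : `|g x| <= B by apply: gB0 => //; rewrite ltrDl.
pose u n := \int[P1 n]_w g (\row_(i < r) pad (rescale R n (kappa n w)) i).
pose v n := \int[P2 n]_w g (\row_(i < r) pad (Xm n w) i).
pose del n : R := (m n)%:R ^+ 3 / n%:R.
pose e n : R := 2 * K * simplex_volume R (m n).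
pose rho n := (1 + e n) ^+ 2 / (1 - e n) * expR (6 * del n).
have del0 : del n @[n --> \oo] --> 0 by exact: cvg_cube_ratio.
have e0 : e n @[n --> \oo] --> 0.
  by rewrite -[X in _ --> X](mulr0 (2 * K)); apply: cvgMl_tmp; exact: cvg_simplex_volume.
have rho1 : rho n @[n --> \oo] --> (1 : R).
  have -> : 1 = (1 + 0) ^+ 2 / (1 - 0) * expR (6 * 0) :> R.
    by rewrite mulr0 expR0 mulr1 addr0 subr0 expr1n divr1.
  apply: cvgM.
    have e1 : 1 + e n @[n --> \oo] --> (1 + 0 : R) by apply: cvgD => //; exact: cvg_cst.
    apply: cvgM; first exact: (cvgM e1 e1).
    apply: cvgV; first by rewrite subr0 oner_eq0.
    by apply: cvgB => //; exact: cvg_cst.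
  have del6 : 6 * del n @[n --> \oo] --> (6 * 0 : R) by apply: cvgMl_tmp.
  exact: (cvg_comp _ expR del6 (@continuous_expR R _)).
(* The main step. One half of [eps] pays for the rounding, by uniform continuity of [g] on the unit
   cube; the other half pays for the ratio of the laws, since [rho] tends to 1. *)
have uv0 : u n - v n @[n --> \oo] --> 0.
  apply/cvgrPdist_le => eps eps_gt0.
  have cube : compact [set x : 'rV[R]_r | forall i, `[0, 1]%classic (x ord0 i)].
    exact: (@rV_compact R r (fun=> `[0, 1]%classic) (fun=> @segment_compact R 0 1)).
  have eps2 : 0 < eps / 2 by rewrite divr_gt0.
  have [dl dl0 gdl] := compact_unif_continuous cube g_cont eps2.
  have B_ge0 : 0 <= B by exact: le_trans (normr_ge0 _) (gB 0).
  have rhoB : 2 * B * (rho n - 1) @[n --> \oo] --> 0.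
    rewrite -[X in _ --> X](mulr0 (2 * B)); apply: cvgMl_tmp.
    by rewrite -[X in _ --> X](subrr 1); apply: cvgB => //; exact: cvg_cst.
  near=> n; have n0 : (0 < n)%N by near: n; exact: nbhs_infty_gt.
  have nR : 0 < (n%:R : R) by rewrite ltr0n.
  have rm : (r < m n)%N by near: n; exact: (m_oo _ (nbhs_infty_gt r)).
  have mn : (2 * m n ^ 3 <= n)%N.
    (* The condition 2 m^3 <= n says that [del n] is at most 1/2, which holds eventually. *)
    have : del n < 2^-1.
      by near: n; apply: (cvgr_lt _ del0); rewrite invr_gt0.
    rewrite ltr_pdivrMr// mulrC ltr_pdivlMr// mulrC => /ltW.
    by rewrite -natrX -natrM ler_nat.
  have e1 : e n < 1 by near: n; apply: (cvgr_lt _ e0).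
  have ndl : del n < dl by near: n; apply: (cvgr_lt _ del0).
  have gdl' (x y : 'rV[R]_r) : (forall i, 0 <= x ord0 i <= 1) ->
      (forall i, `|x ord0 i - y ord0 i| < dl) -> `|g x - g y| <= eps / 2.
    by move=> x01; apply: gdl => i; rewrite /= in_itv; exact: x01.
  have rho_le : 2 * B * (rho n - 1) <= eps / 2.
    by near: n; apply: (cvgr_le _ rhoB).
  have := expectation_partition_close (ltW K_gt0) (f_pdf n n0) (f_lip n n0)
    (kappa_prob n n0) (Xm_density n n0) rm mn e1 g_cont gB (ltW eps2) ndl gdl'.
  rewrite sub0r normrN => /le_trans; apply.
  by rewrite [leRHS](splitr eps) lerD2r.
have uE n :
    'E_(P1 n)[g \o (fun w => \row_(i < r) pad (rescale R n (kappa n w)) i)]%E =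
    (u n)%:E.
  apply: (@expectation_Rintegral _ _ _ _ _ B) => [|w]; last exact: gB.
  have mG : measurable_fun setT
      (fun k : (m n).-tuple nat => g (\row_(i < r) pad (rescale R n k) i)).
    by move=> _ A _; exact: measurable_tuple_nat.
  exact: (measurableT_comp mG (measurable_funPT (kappa n))).
have vE n : 'E_(P2 n)[g \o (fun w => \row_(i < r) pad (Xm n w) i)]%E = (v n)%:E.
  apply: (@expectation_Rintegral _ _ _ _ _ B) => [|w]; last exact: gB.
  exact: (measurable_continuous_pad (measurable_funPT (Xm n)) g_cont).
have lim : ((v n)%:E @[n --> \oo] --> 'E_P[g \o (fun w => \row_(i < r) X w i)])%E.
  by under eq_fun do rewrite -vE; exact: Xm_cvg.
under eq_fun do rewrite uE.
(* The expectations for the partitions differ from the convergent ones by a null sequence. The sum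
   of the limits is defined because the second one, 0, is finite. *)
rewrite (_ : (fun n => (u n)%:E) = (fun n => (v n)%:E + (u n - v n)%:E)%E).
  have uv0E : ((u n - v n)%:E @[n --> \oo] --> 0%:E)%E.
    by apply: cvg_EFin => //; exact: nearW.
  have := cvgeD (fin_num_adde_defl _ (isT : (0%:E : \bar R) \is a fin_num)) lim uv0E.
  by rewrite adde0; apply.
by apply/funext => n; rewrite -EFinD addrC subrK.
Unshelve. all: by end_near.
Qed.
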